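(* Let $\Omega_n=\dfrac{\pi^{n/2}}{\Gamma\left(\frac n2+1\right)}$ for $n\in\mathbb{N}_0$. Let $c_0=1$ and, for $j\in\mathbb{N}$, \[ c_j=\frac1j\sum_{k=1}^j(-1)^k\left[B_{k+1}\left(\tfrac12\right)-B_{k+1}(1)\right]\frac{2^k}{k+1}c_{j-k}, \] where $B_m(x)$ are the Bernoulli polynomials. As $n\to\infty$, the following asymptotic formula holds: \[ \frac{\Omega_{n-1}}{\Omega_n}=\sqrt{\frac{n+\frac12}{2\pi}+\sum_{j=1}^\infty\frac{s_j}{n^j}},\qquad s_j=\frac1{2\pi}\sum_{k=0}^{j+1}c_kc_{j+1-k}\quad(j\in\mathbb{N}). \]
   Context: $\Omega_n$ is the volume of the unit ball in $\mathbb{R}^n$; $\Gamma$ is Euler's gamma function. The Bernoulli polynomials are defined by $\frac{te^{xt}}{e^t-1}=\sum_{m\ge0}B_m(x)\frac{t^m}{m!}$. The formula is an asymptotic expansion: for every $N$, $\left(\frac{\Omega_{n-1}}{\Omega_n}\right)^2-\frac{n+1/2}{2\pi}-\sum_{j=1}^Ns_jn^{-j}=O(n^{-N-1})$ as $n\to\infty$. *)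

(* Defs.v *)
From Stdlib Require Import Reals List.
From Coquelicot Require Import Coquelicot.
Import ListNotations.
Open Scope R_scope.

Definition Gamma (x : R) : R :=
  RInt_gen (fun t => Rpower t (x - 1) * exp (- t)) (at_right 0) (Rbar_locally p_infty).

Definition Omega (n : nat) : R :=
  Rpower PI (INR n / 2) / Gamma (INR n / 2 + 1).

(* Bernoulli polynomials via the generating function t e^{xt}/(e^t - 1)
   = sum_m B_m(x) t^m/m!, i.e. B_m(x) is the m-th derivative at t = 0 of the
   (smooth, removable singularity filled in by its limit 1) generating function. *)
Definition bern_gen (x t : R) : R :=
  if Req_EM_T t 0 then 1 else t * exp (x * t) / (exp t - 1).
Definition bernpoly (m : nat) (x : R) : R := Derive_n (bern_gen x) m 0.

Definition fsum (a b : nat) (f : nat -> R) : R :=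
  fold_right Rplus 0 (map f (seq a (S b - a))).

(* strong recursion: srec f n = f n (fun k => srec f k) for k < n *)
Fixpoint hist (f : nat -> (nat -> R) -> R) (n : nat) : list R :=
  match n with
  | O => [f O (fun _ => 0)]
  | S m => let l := hist f m in l ++ [f (S m) (fun k => nth k l 0)]
  end.
Definition srec (f : nat -> (nat -> R) -> R) (n : nat) : R := nth n (hist f n) 0.

Definition c_step (j : nat) (c : nat -> R) : R :=
  match j with
  | O => 1
  | S _ => / INR j * fsum 1 j (fun k =>
             (-1) ^ k * (bernpoly (S k) (1/2) - bernpoly (S k) 1)
             * 2 ^ k / INR (S k) * c (j - k)%nat)
  end.
Definition cc (j : nat) : R := srec c_step j.

Definition s (j : nat) : R :=
  / (2 * PI) * fsum 0 (S j) (fun k => cc k * cc (S j - k)).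

(* Main.v *)
(* The ratio T(n) = (Omega_(n-1) / Omega_n)^2 satisfies T(n) T(n-1) = (n / (2 pi))^2 since
   Gamma(x+1) = x Gamma(x), and n / (2 pi) <= T(n) <= (n+1) / (2 pi) since
   Gamma(x+1/2) <= sqrt(x) Gamma(x) by AM-GM under the integral. These two facts determine the
   expansion of T, so it suffices that the formal series P(u) = sum_k c_k u^k, u = 1/n, solves
   (P(u) P(v))^2 (1-u) = 1 with v = u/(1-u), i.e. 1/v = n-1. Put tau(t) = 1/(1+e^t) and
   tau_k = tau^(k)(0). The difference of the Bernoulli generating functions at 1/2 and 1 is
   -t tau(-t/2), so the recursion for c_k reads u P' = (1/2 - sum_k tau_k u^k) P, and the
   functional equation, after logarithmic differentiation, becomes
   tau_m + sum_k C(m,k) tau_k = [m = 0], which is the Leibniz rule for tau (1 + e^t) = 1. *)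

Require Import Defs.
From Stdlib Require Import Reals List Factorial Lra Lia.
From Coquelicot Require Import Coquelicot.
Open Scope R_scope.

(** * Truncated power series and jets *)

(** Horner's scheme with [n] terms, so the last exponent is n - 1. Peeling off the constant term
    matches the recursion of [jet]. *)
Fixpoint psum (n : nat) (a : nat -> R) (u : R) : R :=
  match n with
  | O => 0
  | S m => a O + u * psum m (fun k => a (S k)) u
  end.

Definition conv (a b : nat -> R) (n : nat) : R :=
  fsum 0 n (fun k => a k * b (n - k)%nat).

Lemma fsum0_S (n : nat) (f : nat -> R) :
  fsum 0 (S n) f = f O + fsum 0 n (fun k => f (S k)).
Proof.
  unfold fsum. rewrite !Nat.sub_0_r. cbn [seq map fold_right].
  f_equal. change (f 1%nat + fold_right Rplus 0 (map f (seq 2 n)))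
    with (fold_right Rplus 0 (map f (seq 1 (S n)))).
  now rewrite <- seq_shift, map_map.
Qed.

Lemma fsum1_S (n : nat) (f : nat -> R) :
  fsum 1 (S n) f = fsum 0 n (fun k => f (S k)).
Proof.
  unfold fsum. rewrite Nat.sub_0_r.
  replace (S (S n) - 1)%nat with (S n) by lia.
  now rewrite <- seq_shift, map_map.
Qed.

Lemma fsum_scal (a b : nat) (c : R) (f : nat -> R) :
  fsum a b (fun k => c * f k) = c * fsum a b f.
Proof.
  unfold fsum. induction (seq a (S b - a)) as [|k l IH]; simpl; [ring|rewrite IH; ring].
Qed.

Lemma fsum_ext (a b : nat) (f g : nat -> R) :
  (forall k, (a <= k <= b)%nat -> f k = g k) -> fsum a b f = fsum a b g.
Proof.
  intros H. unfold fsum. f_equal. apply map_ext_in.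
  intros k Hk. apply in_seq in Hk. apply H. lia.
Qed.

Lemma conv_0 (a b : nat -> R) : conv a b 0 = a O * b O.
Proof. unfold conv, fsum. simpl. ring. Qed.

Lemma conv_S (a b : nat -> R) (n : nat) :
  conv a b (S n) = a O * b (S n) + conv (fun k => a (S k)) b n.
Proof. unfold conv. now rewrite fsum0_S. Qed.

(* [jet n r f a] says that f(u) = a_0 + a_1 u + ... + a_(n-1) u^(n-1) + O(u^n) on (0, r]. *)
Fixpoint jet (n : nat) (r : R) (f : R -> R) (a : nat -> R) : Prop :=
  match n with
  | O => exists K, forall u, 0 < u <= r -> Rabs (f u) <= K
  | S m => jet m r (fun u => (f u - a O) / u) (fun k => a (S k))
  end.

Lemma jet_ext (n : nat) : forall (r : R) (f g : R -> R) (a b : nat -> R),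
  (forall u, 0 < u <= r -> f u = g u) -> (forall k, (k < n)%nat -> a k = b k) ->
  jet n r f a -> jet n r g b.
Proof.
  induction n as [|n IH]; simpl; intros r f g a b Hf Hab H.
  - destruct H as [K HK]. exists K. intros u Hu. rewrite <- Hf; auto.
  - apply IH with (3 := H).
    + intros u Hu. rewrite Hf, (Hab O); auto. lia.
    + intros k Hk. apply Hab. lia.
Qed.

Lemma jet_plus (n : nat) : forall (r : R) (f g : R -> R) (a b : nat -> R),
  jet n r f a -> jet n r g b ->
  jet n r (fun u => f u + g u) (fun k => a k + b k).
Proof.
  induction n as [|n IH]; simpl; intros r f g a b Hf Hg.
  - destruct Hf as [K HK], Hg as [L HL]. exists (K + L). intros u Hu.
    apply Rle_trans with (1 := Rabs_triang _ _).
    specialize (HK u Hu); specialize (HL u Hu); lra.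
  - apply jet_ext with (3 := IH _ _ _ _ _ Hf Hg).
    + intros u Hu. field. lra.
    + reflexivity.
Qed.

Lemma jet_scal (n : nat) : forall (r c : R) (f : R -> R) (a : nat -> R),
  jet n r f a -> jet n r (fun u => c * f u) (fun k => c * a k).
Proof.
  induction n as [|n IH]; simpl; intros r c f a Hf.
  - destruct Hf as [K HK]. exists (Rabs c * K). intros u Hu.
    rewrite Rabs_mult. apply Rmult_le_compat_l; auto using Rabs_pos.
  - apply jet_ext with (3 := IH _ c _ _ Hf).
    + intros u Hu. field. lra.
    + reflexivity.
Qed.

Lemma jet_pred (n : nat) : forall (r : R) (f : R -> R) (a : nat -> R),
  jet (S n) r f a -> jet n r f a.
Proof.
  induction n as [|n IH]; intros r f a H.
  - destruct H as [K HK]. exists (Rabs (a O) + r * K). intros u Hu.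
    specialize (HK u Hu).
    replace (f u) with (a O + u * ((f u - a O) / u)) by (field; lra).
    apply Rle_trans with (1 := Rabs_triang _ _).
    apply Rplus_le_compat_l.
    rewrite Rabs_mult, (Rabs_right u) by lra.
    apply Rmult_le_compat; auto using Rabs_pos; lra.
  - simpl. apply IH. exact H.
Qed.

(** By f g - a_0 b_0 = a_0 (g - b_0) + (f - a_0) g, division by u leaves two products of order n; in
    the second, g is weakened by [jet_pred]. *)
Lemma jet_mult (n : nat) : forall (r : R) (f g : R -> R) (a b : nat -> R),
  jet n r f a -> jet n r g b -> jet n r (fun u => f u * g u) (conv a b).
Proof.
  induction n as [|n IH]; intros r f g a b Hf Hg.
  - destruct Hf as [K HK], Hg as [L HL]. exists (K * L). intros u Hu.
    rewrite Rabs_mult. apply Rmult_le_compat; auto using Rabs_pos.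
  - simpl.
    pose proof (IH _ _ _ _ _ Hf (jet_pred _ _ _ _ Hg)) as H1.
    pose proof (jet_scal n r (a O) _ _ Hg) as H2.
    apply jet_ext with (3 := jet_plus _ _ _ _ _ _ H2 H1).
    + intros u Hu. rewrite conv_0. field. lra.
    + intros k _. now rewrite conv_S.
Qed.

Lemma jet_psum (n : nat) : forall (r : R) (a : nat -> R), jet n r (psum n a) a.
Proof.
  induction n as [|n IH]; intros r a.
  - exists 0. intros u _. simpl. rewrite Rabs_R0. lra.
  - simpl. apply jet_ext with (3 := IH r (fun k => a (S k))).
    + intros u Hu. field. lra.
    + reflexivity.
Qed.

Lemma jet_remainder (n : nat) : forall (r : R) (f : R -> R) (a : nat -> R),
  jet n r f a ->
  exists K, forall u, 0 < u <= r -> Rabs (f u - psum n a u) <= K * u ^ n.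
Proof.
  induction n as [|n IH]; intros r f a H.
  - destruct H as [K HK]. exists K. intros u Hu. simpl.
    rewrite Rminus_0_r, Rmult_1_r. auto.
  - destruct (IH _ _ _ H) as [K HK]. exists K. intros u Hu.
    specialize (HK u Hu). simpl.
    replace (f u - (a O + u * psum n (fun k => a (S k)) u))
      with (u * ((f u - a O) / u - psum n (fun k => a (S k)) u)) by (field; lra).
    rewrite Rabs_mult, (Rabs_right u) by lra.
    replace (K * (u * u ^ n)) with (u * (K * u ^ n)) by ring.
    apply Rmult_le_compat_l; lra.
Qed.

(** * The Euler transform *)

(* sum_k C(m,k) a_k *)
Fixpoint btrans (m : nat) (a : nat -> R) : R :=
  match m with
  | O => a O
  | S p => btrans p a + btrans p (fun k => a (S k))
  end.

Lemma btrans_ext (m : nat) : forall a b : nat -> R,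
  (forall k, a k = b k) -> btrans m a = btrans m b.
Proof.
  induction m as [|m IH]; intros a b H; simpl; auto.
  now rewrite (IH a b), (IH (fun k => a (S k)) (fun k => b (S k))).
Qed.

(** Horner form of sum_k a_k u^k / (1-u)^(k+1), which is what substituting u/(1-u) into [psum]
    produces, up to a factor 1 - u. *)
Fixpoint gsum (n : nat) (a : nat -> R) (u : R) : R :=
  match n with
  | O => 0
  | S m => (a O + u * gsum m (fun k => a (S k)) u) / (1 - u)
  end.

(* The Euler transform: sum_k a_k u^k / (1-u)^(k+1) has coefficients sum_k C(m,k) a_k. *)
Lemma jet_gsum (p : nat) : forall (n : nat) (r : R) (a : nat -> R),
  r < 1 -> (n <= p)%nat -> jet n r (gsum p a) (fun m => btrans m a).
Proof.
  assert (Hb : forall p r a, r < 1 -> jet 0 r (gsum p a) (fun m => btrans m a)).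
  { intros q r. induction q as [|q IH]; intros a Hr.
    - exists 0. intros u _. simpl. rewrite Rabs_R0. lra.
    - destruct (IH (fun k => a (S k)) Hr) as [K HK].
      exists ((Rabs (a O) + r * K) / (1 - r)). intros u Hu. simpl.
      specialize (HK u Hu).
      unfold Rdiv. rewrite Rabs_mult, Rabs_inv, (Rabs_right (1 - u)) by lra.
      apply Rmult_le_compat.
      + apply Rabs_pos.
      + apply Rlt_le, Rinv_0_lt_compat. lra.
      + apply Rle_trans with (1 := Rabs_triang _ _).
        apply Rplus_le_compat_l.
        rewrite Rabs_mult, (Rabs_right u) by lra.
        apply Rmult_le_compat; auto using Rabs_pos; lra.
      + apply Rinv_le_contravar; lra. }
  induction p as [|p IH]; intros n r a Hr Hn.
  - replace n with O by lia. now apply Hb.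
  - induction n as [|n IHn].
    + now apply Hb.
    (* Pascal's rule for functions: subtracting a_0 from [gsum (S p) a u] and dividing by u gives
       the same sum plus the sum of the shifted sequence. The first summand keeps [p] and lowers
       [n], hence the nested induction. *)
    + simpl. apply jet_ext with
        (f := fun u => gsum (S p) a u + gsum p (fun k => a (S k)) u)
        (a := fun m => btrans m a + btrans m (fun k => a (S k))).
      * intros u Hu. simpl. field. lra.
      * reflexivity.
      * apply jet_plus.
        -- apply IHn. lia.
        -- apply IH; auto; lia.
Qed.

Lemma psum_scaled (n : nat) : forall (a : nat -> R) (u : R), u < 1 ->
  psum n a (u / (1 - u)) = (1 - u) * gsum n a u.
Proof.
  induction n as [|n IH]; intros a u Hu; simpl.
  - ring.
  - rewrite IH by easy. field. lra.
Qed.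

Lemma psum_ext (n : nat) : forall (a b : nat -> R) (u : R),
  (forall k, (k < n)%nat -> a k = b k) -> psum n a u = psum n b u.
Proof.
  induction n as [|n IH]; intros a b u H; simpl; auto.
  rewrite (H O) by lia. do 2 f_equal. apply IH. intros; apply H; lia.
Qed.

Lemma psum_plus (n : nat) : forall (a b : nat -> R) (u : R),
  psum n (fun k => a k + b k) u = psum n a u + psum n b u.
Proof. induction n as [|n IH]; intros a b u; simpl; [ring|rewrite IH; ring]. Qed.

(** The operator u d/du multiplies the k-th coefficient by k and keeps the number of terms, which is
    why [u * d] is described rather than [d]. *)
Lemma psum_derive (n : nat) : forall (a : nat -> R) (u : R),
  exists d, is_derive (psum n a) u d /\ u * d = psum n (fun k => INR k * a k) u.
Proof.
  induction n as [|n IH]; intros a u.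
  - exists 0. split.
    + apply (is_derive_const (K := R_AbsRing) (V := R_NormedModule) 0 u).
    + simpl. ring.
  - destruct (IH (fun k => a (S k)) u) as [d [Hd Hu]].
    exists (psum n (fun k => a (S k)) u + u * d). split.
    + simpl. auto_derive.
      * exists d. exact Hd.
      * replace (Derive _ u) with d by (symmetry; now apply is_derive_unique). ring.
    + cbn [psum]. rewrite (psum_ext n (fun k => INR (S k) * a (S k))
        (fun k => INR k * a (S k) + a (S k))).
      * rewrite psum_plus, <- Hu. simpl (INR 0). ring.
      * intros k _. rewrite S_INR. ring.
Qed.

(** The hypothesis is u P' = b P for formal series. After truncation the coefficients below u^n
    still cancel, and the surplus of the product is O(u^n). *)
Lemma remainder_theta_psum (n : nat) (r : R) (b c : nat -> R) :
  (forall m, (m < n)%nat -> INR m * c m = conv b c m) ->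
  exists K, forall u, 0 < u <= r ->
    Rabs (psum n (fun k => INR k * c k) u - psum n b u * psum n c u) <= K * u ^ n.
Proof.
  intros H.
  destruct (jet_remainder n r (fun u => psum n b u * psum n c u) (conv b c)) as [K HK].
  { apply jet_mult; apply jet_psum. }
  exists K. intros u Hu. rewrite Rabs_minus_sym.
  rewrite (psum_ext n (fun k => INR k * c k) (conv b c)) by auto. auto.
Qed.

Lemma pow_scaled_le (n : nat) (u : R) : 0 < u <= 1 / 2 ->
  (u / (1 - u)) ^ n <= 2 ^ n * u ^ n.
Proof.
  intros Hu. rewrite <- Rpow_mult_distr. apply pow_incr. split.
  - apply Rdiv_le_0_compat; lra.
  - apply Rmult_le_reg_r with (1 - u); [lra|].
    replace (u / (1 - u) * (1 - u)) with u by (field; lra). nra.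
Qed.

Lemma psum_bounded (n : nat) (r : R) (a : nat -> R) :
  exists K, forall u, 0 < u <= r -> Rabs (psum n a u) <= K.
Proof.
  induction n as [|n IH] in a |- *.
  - exists 0. intros. simpl. rewrite Rabs_R0. lra.
  - destruct (IH (fun k => a (S k))) as [K HK].
    exists (Rabs (a O) + r * K). intros u Hu. specialize (HK u Hu). simpl.
    apply Rle_trans with (1 := Rabs_triang _ _). apply Rplus_le_compat_l.
    rewrite Rabs_mult, (Rabs_right u) by lra.
    apply Rmult_le_compat; auto using Rabs_pos; lra.
Qed.

(** * The functional equation *)

Lemma Rabs_mult_le (x y X Y : R) :
  Rabs x <= X -> Rabs y <= Y -> Rabs (x * y) <= X * Y.
Proof. intros. rewrite Rabs_mult. apply Rmult_le_compat; auto using Rabs_pos. Qed.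

Lemma Rabs_plus_le (x y X Y : R) :
  Rabs x <= X -> Rabs y <= Y -> Rabs (x + y) <= X + Y.
Proof. intros. apply Rle_trans with (1 := Rabs_triang _ _). lra. Qed.

(** Since u dv/du = v/(1-u), the operator u d/du sends f(v) to tf(v)/(1-u). The factor 1 - x cancels
    this denominator, and its own derivative gives the last term. *)
Lemma psum_functional_equation_derive (n : nat) (c : nat -> R) (u : R) : u < 1 ->
  let f := psum n c in
  let tf := psum n (fun k => INR k * c k) in
  let v := u / (1 - u) in
  exists d,
    is_derive (fun x => (f x * f (x / (1 - x))) ^ 2 * (1 - x)) u d /\
    u * d = 2 * f u * f v * (tf u * f v * (1 - u) + f u * tf v) - u * (f u * f v) ^ 2.
Proof.
  intros Hu f tf v.
  destruct (psum_derive n c u) as [d1 [D1 E1]].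
  destruct (psum_derive n c v) as [d2 [D2 E2]].
  exists (2 * (f u * f v) * (d1 * f v + f u * (d2 / (1 - u) ^ 2)) * (1 - u)
          - (f u * f v) ^ 2).
  split.
  - fold f in D1, D2.
    assert (Dv : is_derive (fun x => x / (1 - x)) u (/ (1 - u) ^ 2)).
    { auto_derive; [lra|]. field. lra. }
    pose proof (is_derive_comp f (fun x => x / (1 - x)) u _ _ D2 Dv) as D3.
    set (g := fun x => f (x / (1 - x))) in *.
    apply (is_derive_ext (fun x => (f x * g x) ^ 2 * (1 - x))); [reflexivity|].
    auto_derive.
    + repeat split; [exists d1; exact D1|eexists; exact D3].
    + replace (Derive (fun x => f x) u) with d1 by (symmetry; now apply is_derive_unique).
      replace (Derive (fun x => g x) u) with (/ (1 - u) ^ 2 * d2)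
        by (symmetry; now apply is_derive_unique).
      change (g u) with (f v). field. lra.
  - unfold tf. rewrite <- E1, <- E2. unfold v. field. lra.
Qed.

(* [u] times the derivative of the left-hand square is a multiple of [1 - t(u) - gsum u]
   up to O(u^n), where t(u) = sum_k tau_k u^k. *)
Lemma psum_functional_equation (n : nat) (c tau : nat -> R) :
  c O = 1 ->
  (forall m, INR m * c m
     = conv (fun k => (match k with O => 1/2 | S _ => 0 end) - tau k) c m) ->
  (forall m, tau m + btrans m tau = match m with O => 1 | S _ => 0 end) ->
  exists K, forall u, 0 < u <= 1/2 ->
    Rabs ((psum (S n) c u * psum (S n) c (u / (1 - u))) ^ 2 * (1 - u) - 1) <= K * u ^ S n.
Proof.
  intros Hc0 Hc Ht.
  set (b := fun k => (match k with O => 1/2 | S _ => 0 end) - tau k) in Hc.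
  destruct (remainder_theta_psum (S n) 1 b c) as [K1 HK1]; [auto|].
  destruct (psum_bounded (S n) 1 c) as [B HB].
  (* By the hypothesis on [tau] this sum has the jet of the constant 1. The radius 1/2 keeps 1 - u
     away from 0 and u/(1-u) at most 1. *)
  destruct (jet_remainder (S n) (1/2)
    (fun u => psum (S n) tau u + gsum (S n) tau u) (fun m => tau m + btrans m tau))
    as [K2 HK2].
  { apply jet_plus; [apply jet_psum|apply jet_gsum; [lra|lia]]. }
  assert (HK3 : forall u, 0 < u <= 1/2 ->
    Rabs (1 - psum (S n) tau u - gsum (S n) tau u) <= K2 * u ^ S n).
  { intros u Hu. specialize (HK2 u Hu). rewrite Rabs_minus_sym in HK2.
    rewrite (psum_ext _ _ (fun m => match m with O => 1 | S _ => 0 end)) in HK2 by auto.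
    replace (psum (S n) (fun m => match m with O => 1 | S _ => 0 end) u) with 1 in HK2.
    - replace (1 - psum (S n) tau u - gsum (S n) tau u)
        with (1 - (psum (S n) tau u + gsum (S n) tau u)) by ring. exact HK2.
    - simpl. replace (psum n (fun _ => 0) u) with 0; [ring|].
      clear. induction n as [|n IH]; simpl; [|rewrite <- IH]; ring. }
  assert (Hb : forall u, psum (S n) b u = 1/2 - psum (S n) tau u).
  { intros u. unfold b. cbn [psum].
    assert (E : psum n (fun k => 0 - tau (S k)) u = - psum n (fun k => tau (S k)) u).
    { clear. 
      assert (H : forall (t : nat -> R), psum n (fun k => 0 - t k) u = - psum n t u).
      { induction n as [|n IH]; intros t; simpl; [ring|].
        rewrite (IH (fun k => t (S k))). ring. }
      exact (H (fun k => tau (S k))). }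
    rewrite E. ring. }
  set (f := psum (S n) c) in *.
  set (W := fun u => (f u * f (u / (1 - u))) ^ 2 * (1 - u)).
  (* [B] bounds f on (0, 1], [K1] and [K2] are the two remainder constants, and 2^(n+1) compares
     v^(n+1) with u^(n+1). *)
  set (K := 2 * (B * B * (B * B)) * K2 + 2 * B * B * (B * K1 + B * (K1 * 2 ^ S n))).
  assert (HW : forall u, 0 < u <= 1/2 -> Rabs (u * Derive W u) <= K * u ^ S n).
  { intros u Hu.
    assert (Hv : 0 < u / (1 - u) <= 1).
    { split; [apply Rdiv_lt_0_compat; lra|].
      apply Rmult_le_reg_r with (1 - u); [lra|].
      replace (u / (1 - u) * (1 - u)) with u by (field; lra). lra. }
    destruct (psum_functional_equation_derive (S n) c u) as [d [D E]]; [lra|].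
    fold f in D, E.
    replace (Derive W u) with d by (symmetry; apply is_derive_unique; exact D).
    rewrite E. clear D E.
    assert (H1 := HK1 u ltac:(lra)).
    assert (H2 := HK1 _ Hv).
    assert (H3 := HK3 u Hu).
    assert (B1 := HB u ltac:(lra)).
    assert (B2 := HB _ Hv).
    assert (Hp := pow_scaled_le (S n) u Hu).
    assert (Et : psum (S n) tau (u / (1 - u)) = (1 - u) * gsum (S n) tau u)
      by (apply psum_scaled; lra).
    rewrite Hb in H1, H2. rewrite Et in H2.
    set (v := u / (1 - u)) in *.
    set (tu := psum (S n) tau u) in *. set (g := gsum (S n) tau u) in *.
    set (p := psum (S n) (fun k => INR k * c k) u) in *.
    set (q := psum (S n) (fun k => INR k * c k) v) in *.
    set (e1 := p - (1 / 2 - tu) * f u) in *.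
    set (e2 := q - (1 / 2 - (1 - u) * g) * f v) in *.
    assert (K1pos : 0 <= K1).
    { assert (0 < u ^ S n) by (apply pow_lt; lra).
      assert (P := Rabs_pos e1). nra. }
    (* Inserting p = (1/2 - t(u)) f(u) + e1 and q = (1/2 - (1-u) g) f(v) + e2, the main terms
       combine to 2 (1-u) (f(u) f(v))^2 (1 - t(u) - g); the rest is linear in the errors. *)
    replace (2 * f u * f v * (p * f v * (1 - u) + f u * q) - u * (f u * f v) ^ 2)
      with ((1 - u) * ((2 * ((f u * f u) * (f v * f v))) * (1 - tu - g))
            + (2 * f u * f v) * ((1 - u) * (f v * e1) + f u * e2))
      by (unfold e1, e2; field).
    (* The bound is laid out in the shape of the expression, so that the product and sum estimates
       apply factor by factor. *)
    replace (K * u ^ S n) with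
      (1 * (2 * (B * B * (B * B)) * (K2 * u ^ S n))
       + 2 * B * B * (1 * (B * (K1 * u ^ S n)) + B * (K1 * (2 ^ S n * u ^ S n))))
      by (unfold K; ring).
    assert (A1 : Rabs (1 - u) <= 1) by (rewrite Rabs_right; lra).
    assert (A2 : Rabs 2 <= 2) by (rewrite Rabs_right; lra).
    assert (H4 : Rabs e2 <= K1 * (2 ^ S n * u ^ S n)).
    { apply Rle_trans with (1 := H2). apply Rmult_le_compat_l; assumption. }
    repeat (assumption || apply Rabs_mult_le || apply Rabs_plus_le). }
  exists K. intros u Hu.
  (* Here W(0) = c_0^4 = 1. Dividing the bound on z W'(z) by z costs one power, and the factor u of
     the mean value theorem restores it. *)
  destruct (MVT_cor2 W (Derive W) 0 u) as [z [Ez Hz]]; [lra| |].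
  { intros z Hz. apply is_derive_Reals, Derive_correct.
    destruct (psum_functional_equation_derive (S n) c z) as [d [D _]]; [lra|].
    exists d. exact D. }
  replace (W 0) with 1 in Ez.
  2: { unfold W, f. replace (0 / (1 - 0)) with 0 by field. cbn [psum].
       rewrite Hc0. ring. }
  fold (W u). rewrite Ez, Rminus_0_r.
  assert (Hz1 : Rabs (Derive W z) <= K * z ^ n).
  { apply Rmult_le_reg_l with z; [lra|].
    replace (z * (K * z ^ n)) with (K * z ^ S n) by (simpl; ring).
    rewrite <- (Rabs_right z) at 1 by lra. rewrite <- Rabs_mult. apply HW. lra. }
  replace (K * u ^ S n) with (K * u ^ n * u) by (simpl; ring).
  apply Rabs_mult_le; [|rewrite Rabs_right; lra].
  apply Rle_trans with (1 := Hz1). apply Rmult_le_compat_l.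
  - assert (0 < z ^ n) by (apply pow_lt; lra).
    assert (P := Rabs_pos (Derive W z)). nra.
  - apply pow_incr. lra.
Qed.

(** * The Bernoulli coefficients *)

(** Each level carries its derivative as a global witness, so closure under products and inverses is
    a plain induction. *)
Fixpoint differentiable_n (n : nat) (f : R -> R) : Prop :=
  match n with
  | O => True
  | S m => exists g, (forall x, is_derive f x (g x)) /\ differentiable_n m g
  end.

Lemma differentiable_n_pred (n : nat) : forall f,
  differentiable_n (S n) f -> differentiable_n n f.
Proof.
  induction n as [|n IH]; intros f [g [Hg H]]; [exact I|].
  exists g. split; [assumption|]. apply IH, H.
Qed.

Lemma differentiable_n_const (n : nat) : forall c, differentiable_n n (fun _ => c).
Proof.
  induction n as [|n IH]; intros c; [exact I|].
  exists (fun _ => 0). split; [|apply IH].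
  intros x. apply (is_derive_const (K := R_AbsRing) (V := R_NormedModule) c x).
Qed.

Lemma differentiable_n_plus (n : nat) : forall f g,
  differentiable_n n f -> differentiable_n n g ->
  differentiable_n n (fun x => f x + g x).
Proof.
  induction n as [|n IH]; [easy|].
  intros f g [f' [Hf Nf]] [g' [Hg Ng]].
  exists (fun x => f' x + g' x). split; [|now apply IH].
  intros x. now apply (is_derive_plus f g).
Qed.

Lemma differentiable_n_mult (n : nat) : forall f g,
  differentiable_n n f -> differentiable_n n g ->
  differentiable_n n (fun x => f x * g x).
Proof.
  induction n as [|n IH]; [easy|].
  intros f g Nf Ng.
  pose proof (differentiable_n_pred _ _ Nf) as Pf.
  pose proof (differentiable_n_pred _ _ Ng) as Pg.
  destruct Nf as [f' [Hf Nf]], Ng as [g' [Hg Ng]].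
  exists (fun x => f' x * g x + f x * g' x). split.
  - intros x. apply (is_derive_mult f g); auto. intros; apply Rmult_comm.
  - apply differentiable_n_plus; now apply IH.
Qed.

Lemma differentiable_n_inv (n : nat) : forall f, (forall x, f x <> 0) ->
  differentiable_n n f -> differentiable_n n (fun x => / f x).
Proof.
  induction n as [|n IH]; [easy|].
  intros f Hn Nf. pose proof (IH _ Hn (differentiable_n_pred _ _ Nf)) as Pf.
  destruct Nf as [f' [Hf Nf]].
  exists (fun x => -1 * (f' x * (/ f x * / f x))). split.
  - intros x. replace (-1 * _) with (- f' x / f x ^ 2) by (field; auto).
    apply is_derive_inv; auto.
  - apply differentiable_n_mult.
    + apply differentiable_n_const.
    + repeat apply differentiable_n_mult; auto.
Qed.

Lemma differentiable_n_ex_derive_n (n : nat) : forall f,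
  differentiable_n n f -> forall x, ex_derive_n f n x.
Proof.
  assert (H : forall n f, differentiable_n (S n) f ->
    forall x, ex_derive (Derive_n f n) x).
  { clear n. induction n as [|n IH]; intros f [g [Hg Ng]] x.
    - exists (g x). apply Hg.
    - apply ex_derive_ext with (2 := IH g Ng x).
      intros y. transitivity (Derive_n (Derive f) n y).
      + apply Derive_n_ext. intros z. symmetry. now apply is_derive_unique.
      + replace (Derive_n f (S n) y) with (Derive_n f (n + 1) y)
          by (f_equal; lia).
        apply (Derive_n_comp f n 1 y). }
  destruct n as [|n]; [easy|]. intros f Hf x. now apply H.
Qed.

Lemma ex_derive_n_differentiable_n (n : nat) (f : R -> R) :
  (forall k x, ex_derive_n f k x) -> differentiable_n n f.
Proof.
  intros H. assert (G : forall k, differentiable_n n (Derive_n f k)).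
  { induction n as [|n IH]; intros k; [exact I|].
    exists (Derive_n f (S k)). split; [|apply IH].
    intros x. apply Derive_correct, (H (S k) x). }
  apply (G O).
Qed.

Lemma differentiable_n_exp_scal (n : nat) (a : R) :
  differentiable_n n (fun t => exp (a * t)).
Proof.
  induction n as [|n IH]; [exact I|].
  exists (fun t => a * exp (a * t)). split.
  - intros x. auto_derive; [easy|]. ring.
  - apply differentiable_n_mult; [apply differentiable_n_const|exact IH].
Qed.

(** The entire function (e^t - 1)/t, given by its power series so that the singularity at 0 is
    already filled. *)
Definition expm1_div (t : R) : R :=
  PSeries (PS_decr_1 (fun n => / INR (fact n))) t.

Lemma expm1_divE (t : R) : exp t - 1 = t * expm1_div t.
Proof.
  rewrite exp_Reals, PSeries_decr_1.
  - simpl (fact 0). simpl (INR 1). unfold expm1_div. field.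
  - eexists. apply is_exp_Reals.
Qed.

Lemma CV_radius_exp : CV_radius (fun n => / INR (fact n)) = p_infty.
Proof.
  apply CV_radius_infinite_DAlembert.
  - intros n. apply Rinv_neq_0_compat, INR_fact_neq_0.
  - apply is_lim_seq_ext with (fun n => / INR (S n)).
    + intros n. rewrite fact_simpl, mult_INR.
      replace (_ / _) with (/ INR (S n)).
      * rewrite Rabs_right; [easy|]. apply Rle_ge, Rlt_le, Rinv_0_lt_compat.
        apply lt_0_INR. lia.
      * field. split; [apply INR_fact_neq_0|now apply not_0_INR].
    + apply (is_lim_seq_incr_1 (fun n => / INR n)).
      apply (is_lim_seq_inv INR p_infty); [apply is_lim_seq_INR|easy].
Qed.

Lemma expm1_div_0 : expm1_div 0 = 1.
Proof.
  unfold expm1_div. rewrite PSeries_0. unfold PS_decr_1. simpl. field.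
Qed.

Lemma expm1_div_neq_0 (t : R) : expm1_div t <> 0.
Proof.
  destruct (Req_dec t 0) as [->|Ht].
  - rewrite expm1_div_0. lra.
  - intros H. pose proof (expm1_divE t) as E. rewrite H, Rmult_0_r in E.
    apply Ht, exp_inv. rewrite exp_0. lra.
Qed.

(** Without the case distinction, smoothness at 0 follows from that of the two factors. *)
Lemma bern_genE (x t : R) : bern_gen x t = exp (x * t) * / expm1_div t.
Proof.
  unfold bern_gen. destruct (Req_EM_T t 0) as [->|Ht].
  - rewrite expm1_div_0, Rmult_0_r, exp_0. field.
  - rewrite expm1_divE. field. split; [apply expm1_div_neq_0|easy].
Qed.

Lemma ex_derive_n_bern_gen (x : R) (n : nat) (t : R) : ex_derive_n (bern_gen x) n t.
Proof.
  apply ex_derive_n_ext with (fun t => exp (x * t) * / expm1_div t).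
  { intros y. now rewrite bern_genE. }
  revert t. apply differentiable_n_ex_derive_n, differentiable_n_mult.
  - apply differentiable_n_exp_scal.
  - apply differentiable_n_inv; [apply expm1_div_neq_0|].
    apply ex_derive_n_differentiable_n. intros k t.
    apply ex_derive_n_PSeries. now rewrite CV_radius_decr_1, CV_radius_exp.
Qed.

(** The function tau of the overview; tau_k is [Derive_n fermi k 0]. *)
Definition fermi (t : R) : R := / (1 + exp t).

Lemma fermi_differentiable_n (n : nat) : differentiable_n n fermi.
Proof.
  apply differentiable_n_inv.
  - intros x. pose proof (exp_pos x). lra.
  - apply differentiable_n_plus; [apply differentiable_n_const|].
    induction n as [|n IH]; [exact I|]. exists exp. split; [apply is_derive_exp|exact IH].
Qed.

(** With e = e^(t/2) the difference is t (e - e^2)/(e^2 - 1) = -t e/(e + 1) = -t/(1 + 1/e). *)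
Lemma bern_gen_half_minus_one (t : R) :
  bern_gen (1/2) t - bern_gen 1 t = -1 * (t * fermi (- (1/2) * t)).
Proof.
  unfold bern_gen, fermi. destruct (Req_EM_T t 0) as [->|Ht]; [ring|].
  replace (- (1/2) * t) with (- (1/2 * t)) by ring. rewrite exp_Ropp.
  replace (exp (1 * t)) with (exp (1/2 * t) * exp (1/2 * t))
    by (rewrite <- exp_plus; f_equal; field).
  replace (exp t) with (exp (1/2 * t) * exp (1/2 * t))
    by (rewrite <- exp_plus; f_equal; field).
  assert (H1 := exp_pos (1/2 * t)).
  assert (H2 : exp (1/2 * t) <> 1).
  { intros H. apply Ht. assert (E : 1/2 * t = 0) by (apply exp_inv; now rewrite exp_0).
    lra. }
  set (e := exp (1/2 * t)) in *. field.
  repeat split; nra.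
Qed.

(** Leibniz' rule, where only two terms survive because t'' = 0. At x = 0 just the second remains,
    which turns B_(k+1) into a k-th derivative. *)
Lemma Derive_n_id_mult (f : R -> R) (n : nat) :
  (forall k x, ex_derive_n f k x) -> forall x,
  Derive_n (fun t => t * f t) (S n) x
  = x * Derive_n f (S n) x + INR (S n) * Derive_n f n x.
Proof.
  intros Hf. induction n as [|n IH]; intros x.
  - change (Derive (fun t => t * f t) x = x * Derive f x + 1 * f x).
    rewrite Derive_mult; [|apply ex_derive_id|apply (Hf 1%nat)].
    rewrite Derive_id. ring.
  - change (Derive (Derive_n (fun t => t * f t) (S n)) x
      = x * Derive_n f (S (S n)) x + INR (S (S n)) * Derive_n f (S n) x).
    rewrite (Derive_ext _ _ _ IH).
    apply is_derive_unique.
    pose proof (Derive_correct _ _ (Hf (S n) x)) as D1.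
    pose proof (Derive_correct _ _ (Hf (S (S n)) x)) as D2.
    change (is_derive (Derive_n f n) x (Derive_n f (S n) x)) in D1.
    change (is_derive (Derive_n f (S n)) x (Derive_n f (S (S n)) x)) in D2.
    set (g := Derive_n f n) in *. set (h := Derive_n f (S n)) in *.
    set (l := Derive_n f (S (S n)) x) in *.
    rewrite (S_INR (S n)). set (c := INR (S n)).
    auto_derive.
    + repeat split; eexists; eassumption.
    + replace (Derive (fun x => g x) x) with (h x) by (symmetry; now apply is_derive_unique).
      replace (Derive (fun x => h x) x) with l by (symmetry; now apply is_derive_unique).
      ring.
Qed.

Lemma bernpoly_half_minus_one (k : nat) :
  bernpoly (S k) (1/2) - bernpoly (S k) 1
  = - (INR (S k) * ((- (1/2)) ^ k * Derive_n fermi k 0)).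
Proof.
  unfold bernpoly. rewrite <- Derive_n_minus;
    [|exists (mkposreal 1 Rlt_0_1); intros; apply ex_derive_n_bern_gen
     |exists (mkposreal 1 Rlt_0_1); intros; apply ex_derive_n_bern_gen].
  rewrite (Derive_n_ext _ _ _ _ bern_gen_half_minus_one), Derive_n_scal_l.
  rewrite Derive_n_id_mult.
  - rewrite (Derive_n_comp_scal fermi _ k).
    + rewrite (Rmult_0_r (- (1/2))). ring.
    + exists (mkposreal 1 Rlt_0_1). intros. apply differentiable_n_ex_derive_n.
      apply fermi_differentiable_n.
  - intros n x. apply ex_derive_n_comp_scal.
    exists (mkposreal 1 Rlt_0_1). intros. apply differentiable_n_ex_derive_n.
    apply fermi_differentiable_n.
Qed.

(** The inner scaling by -1/2 contributes (-1/2)^k, exactly cancelled by the factors (-1)^k and 2^k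
    in [c_step]; k + 1 cancels against the Leibniz factor. *)
Lemma bernoulli_coefficient (k : nat) :
  (-1) ^ k * (bernpoly (S k) (1/2) - bernpoly (S k) 1) * 2 ^ k / INR (S k)
  = - Derive_n fermi k 0.
Proof.
  rewrite bernpoly_half_minus_one.
  assert (E : (-1) ^ k * (- (1/2)) ^ k * 2 ^ k = 1).
  { rewrite <- !Rpow_mult_distr. replace (-1 * - (1/2) * 2) with 1 by field.
    apply pow1. }
  transitivity (- ((-1) ^ k * (- (1/2)) ^ k * 2 ^ k * Derive_n fermi k 0)).
  - field. now apply not_0_INR.
  - rewrite E. ring.
Qed.

(* Differentiate fermi t * e^t = 1 - fermi t repeatedly. *)
Lemma fermi_btrans (m : nat) :
  Derive_n fermi m 0 + btrans m (fun k => Derive_n fermi k 0)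
  = match m with O => 1 | S _ => 0 end.
Proof.
  assert (D : forall j t, is_derive (fun x => Derive_n fermi j x) t (Derive_n fermi (S j) t)).
  { intros j t. apply Derive_correct.
    apply (differentiable_n_ex_derive_n (S j) _ (fermi_differentiable_n _) t). }
  (* The offset [j] generalises the claim over the shifts of the sequence that [btrans] makes in its
     recursion. *)
  assert (Db : forall m j t,
    is_derive (fun t => btrans m (fun k => Derive_n fermi (j + k) t)) t
      (btrans m (fun k => Derive_n fermi (j + S k) t))).
  { intros p. induction p as [|p IH]; intros j t; simpl.
    - rewrite Nat.add_0_r, Nat.add_1_r. apply D.
    - apply (is_derive_plus (V := R_NormedModule)
        (fun t => btrans p (fun k => Derive_n fermi (j + k) t))
        (fun t => btrans p (fun k => Derive_n fermi (j + S k) t))).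
      + apply IH.
      + assert (E : forall i, (j + S i)%nat = (S j + i)%nat) by (intros; lia).
        apply (is_derive_ext (fun t => btrans p (fun k => Derive_n fermi (S j + k) t))).
        * intros s.
          apply btrans_ext. intros i. now rewrite E.
        * replace (btrans p (fun k => Derive_n fermi (j + S (S k)) t))
            with (btrans p (fun k => Derive_n fermi (S j + S k) t)); [apply IH|].
          apply btrans_ext. intros i. now rewrite (E (S i)). }
  (* The identity is kept for all t so that it can be differentiated: the derivative of e^t
     [btrans m] is e^t times [btrans m] of the sequence plus of its shift, that is e^t
     [btrans (S m)]. *)
  assert (H : forall t, exp t * btrans m (fun k => Derive_n fermi k t)
    = (match m with O => 1 | S _ => 0 end) - Derive_n fermi m t).
  { induction m as [|m IH]; intros t.
    - simpl. unfold fermi. pose proof (exp_pos t). field. lra.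
    - assert (D1 : is_derive (fun t => exp t * btrans m (fun k => Derive_n fermi k t)) t
        (exp t * btrans m (fun k => Derive_n fermi k t)
         + exp t * btrans m (fun k => Derive_n fermi (S k) t))).
      { apply (is_derive_mult exp (fun t => btrans m (fun k => Derive_n fermi k t))).
        - apply is_derive_exp.
        - apply (Db m O t).
        - intros; apply Rmult_comm. }
      apply is_derive_unique in D1. rewrite (Derive_ext _ _ _ IH) in D1.
      cbn [btrans]. rewrite Rmult_plus_distr_l, <- D1.
      rewrite Derive_minus, Derive_const; [reflexivity|apply ex_derive_const|].
      eexists. apply D. }
  specialize (H 0). rewrite exp_0 in H. lra.
Qed.

(** * The recursion for the coefficients [cc] *)

Lemma length_hist (f : nat -> (nat -> R) -> R) (n : nat) : length (hist f n) = S n.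
Proof.
  induction n as [|n IH]; [reflexivity|]. simpl. rewrite length_app, IH. simpl. lia.
Qed.

(** [hist] only appends, so an entry once written is final; table lookups in [c_step] are therefore
    values of [cc]. *)
Lemma nth_hist (f : nat -> (nat -> R) -> R) (n k : nat) :
  (k <= n)%nat -> nth k (hist f n) 0 = srec f k.
Proof.
  induction n as [|n IH]; intros Hk.
  - now replace k with O by lia.
  - destruct (Nat.eq_dec k (S n)) as [->|Hn]; [reflexivity|].
    simpl. rewrite app_nth1 by (rewrite length_hist; lia). apply IH. lia.
Qed.

Lemma srec_S (f : nat -> (nat -> R) -> R) (n : nat) :
  srec f (S n) = f (S n) (fun k => nth k (hist f n) 0).
Proof.
  unfold srec. simpl. rewrite app_nth2; rewrite length_hist; [|lia].
  now rewrite Nat.sub_diag.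
Qed.

(** This is u P' = (1/2 - sum_k tau_k u^k) P by coefficients. As tau_0 = 1/2, the term k = 0
    vanishes and the sum from 1 in [c_step] remains. *)
Lemma cc_conv (m : nat) :
  INR m * cc m
  = conv (fun k => (match k with O => 1/2 | S _ => 0 end) - Derive_n fermi k 0) cc m.
Proof.
  assert (H0 : Derive_n fermi 0 0 = 1/2).
  { simpl. unfold fermi. rewrite exp_0. field. }
  destruct m as [|m].
  - rewrite conv_0, H0. simpl (INR 0). ring.
  - rewrite conv_S, H0. unfold conv. rewrite <- fsum1_S with
      (f := fun k => ((match k with O => 1/2 | S _ => 0 end) - Derive_n fermi k 0)
                     * cc (S m - k)).
    unfold cc at 1. rewrite srec_S. unfold c_step.
    rewrite <- Rmult_assoc, Rinv_r by (now apply not_0_INR).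
    rewrite Rmult_1_l, Rminus_diag, Rmult_0_l, Rplus_0_l.
    apply fsum_ext. intros [|k] Hk; [lia|].
    rewrite bernoulli_coefficient, nth_hist by lia. fold c_step. unfold cc. ring.
Qed.

(** * From the functional equation to the expansion *)

(* Consecutive equations give |rho_(m+2) - rho_m| = O(m^-(k+2)), which telescopes. *)
Lemma two_step_rate (rho w : nat -> R) (k : nat) (K : R) :
  (forall m, (2 <= m)%nat -> rho m * rho (m - 1)%nat = 1 + w m) ->
  (forall m, (2 <= m)%nat -> Rabs (w m) <= K / INR m ^ S (S k)) ->
  is_lim_seq rho 1 ->
  exists (L : R) (n0 : nat), forall m, (n0 <= m)%nat ->
    Rabs (rho m - 1) <= L / INR m ^ S k.
Proof.
  intros Hr Hw Hlim.
  assert (HK : 0 <= K).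
  { specialize (Hw 2%nat ltac:(lia)). pose proof (Rabs_pos (w 2%nat)) as P.
    assert (Q : 0 < INR 2 ^ S (S k)) by (apply pow_lt, lt_0_INR; lia).
    apply Rmult_le_reg_r with (/ INR 2 ^ S (S k)).
    - now apply Rinv_0_lt_compat.
    - unfold Rdiv in Hw. lra. }
  apply is_lim_seq_spec in Hlim.
  destruct (Hlim (mkposreal (1/2) ltac:(lra))) as [n1 H1]. simpl in H1.
  (* A factor 2 comes from adding two consecutive errors, another 2 from dividing by a value of
     [rho] above 1/2. *)
  exists (4 * K), (S (S n1)). intros m Hm.
  assert (Hm0 : 0 < INR m) by (apply lt_0_INR; lia).
  assert (Step : forall p, (m <= p)%nat ->
    Rabs (rho (S (S p)) - rho p)
    <= 4 * K / INR m ^ k * (/ INR p - / INR (S (S p)))).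
  { intros p Hp.
    assert (Hp0 : INR m <= INR p) by (apply le_INR; lia).
    pose proof (Hr (S p) ltac:(lia)) as R1. pose proof (Hr (S (S p)) ltac:(lia)) as R2.
    pose proof (Hw (S p) ltac:(lia)) as W1. pose proof (Hw (S (S p)) ltac:(lia)) as W2.
    replace (S p - 1)%nat with p in R1 by lia.
    replace (S (S p) - 1)%nat with (S p) in R2 by lia.
    pose proof (H1 (S p) ltac:(lia)) as B. apply Rabs_def2 in B.
    set (y := INR p + 1).
    assert (E1 : INR (S p) = y) by (unfold y; apply S_INR).
    assert (E2 : INR (S (S p)) = y + 1) by (rewrite S_INR, E1; ring).
    rewrite E2 in *. rewrite E1 in *.
    assert (Hy : 1 < y) by (unfold y; lra).
    assert (W3 : Rabs (w (S (S p))) <= K / y ^ S (S k)).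
    { apply Rle_trans with (1 := W2). apply Rmult_le_compat_l; [assumption|].
      apply Rinv_le_contravar; [apply pow_lt; lra|]. apply pow_incr. lra. }
    (* Two powers of y are kept for telescoping; the other k are bounded through m at once. *)
    assert (HB : K / y ^ S (S k) <= K / INR m ^ k * (/ y ^ 2)).
    { replace (K / y ^ S (S k)) with (K / y ^ k * (/ y ^ 2))
        by (simpl; field; split; [apply pow_nonzero|]; lra).
      apply Rmult_le_compat_r; [apply Rlt_le, Rinv_0_lt_compat, pow_lt; lra|].
      apply Rmult_le_compat_l; [assumption|].
      apply Rinv_le_contravar; [apply pow_lt; lra|]. apply pow_incr. unfold y; lra. }
    (* The telescoping majorant: 1/(y-1) - 1/(y+1) = 2/(y^2 - 1). *)
    assert (HC : / y ^ 2 <= / INR p - / (y + 1)).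
    { replace (INR p) with (y - 1) by (unfold y; ring).
      replace (/ (y - 1) - / (y + 1)) with (2 / (y ^ 2 - 1)) by (field; nra).
      apply Rle_trans with (2 / y ^ 2).
      - apply Rmult_le_reg_r with (y ^ 2); [nra|]. field_simplify; [lra|nra|nra].
      - apply Rmult_le_compat_l; [lra|]. apply Rinv_le_contravar; nra. }
    assert (HKm : 0 <= K / INR m ^ k) by (apply Rdiv_le_0_compat; [|apply pow_lt]; lra).
    apply Rle_trans with (4 * (K / y ^ S (S k))).
    - apply Rmult_le_reg_l with (1/2); [lra|].
      apply Rle_trans with (Rabs (rho (S p)) * Rabs (rho (S (S p)) - rho p)).
      + apply Rmult_le_compat_r; [apply Rabs_pos|].
        apply Rle_trans with (2 := Rle_abs _). lra.
      + rewrite <- Rabs_mult.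
        replace (rho (S p) * (rho (S (S p)) - rho p)) with (w (S (S p)) + - w (S p)) by lra.
        apply Rle_trans with (1 := Rabs_triang _ _). rewrite Rabs_Ropp. lra.
    - replace (4 * K / INR m ^ k) with (4 * (K / INR m ^ k)) by (unfold Rdiv; ring).
      rewrite Rmult_assoc. apply Rmult_le_compat_l; [lra|].
      apply Rle_trans with (1 := HB). now apply Rmult_le_compat_l. }
  assert (HKm : 0 <= 4 * K / INR m ^ k) by (apply Rdiv_le_0_compat; [|apply pow_lt]; lra).
  assert (Tele : forall j, Rabs (rho (m + 2 * j)%nat - rho m)
    <= 4 * K / INR m ^ k * (/ INR m - / INR (m + 2 * j))).
  { induction j as [|j IH].
    - rewrite Nat.mul_0_r, Nat.add_0_r, !Rminus_diag, Rabs_R0. lra.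
    - replace (m + 2 * S j)%nat with (S (S (m + 2 * j))) by lia.
      specialize (Step (m + 2 * j)%nat ltac:(lia)).
      set (p := (m + 2 * j)%nat) in *.
      replace (rho (S (S p)) - rho m) with ((rho (S (S p)) - rho p) + (rho p - rho m)) by ring.
      apply Rle_trans with (1 := Rabs_triang _ _). lra. }
  (* Along m + 2j the sequence tends to 1, so the telescoped bound, uniform in j, passes to the
     limit. *)
  apply le_epsilon. intros eps Heps.
  destruct (Hlim (mkposreal eps Heps)) as [n2 H2]. simpl in H2.
  specialize (Tele n2). specialize (H2 (m + 2 * n2)%nat ltac:(lia)).
  replace (rho m - 1) with (- (rho (m + 2 * n2)%nat - rho m) + (rho (m + 2 * n2)%nat - 1))
    by ring.
  apply Rle_trans with (1 := Rabs_triang _ _). rewrite Rabs_Ropp.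
  assert (Hi : 0 < / INR (m + 2 * n2)) by (apply Rinv_0_lt_compat, lt_0_INR; lia).
  replace (4 * K / INR m ^ S k) with (4 * K / INR m ^ k * / INR m)
    by (simpl; field; split; [apply pow_nonzero|]; lra).
  nra.
Qed.

(** The quotient rho = P^2/q tends to 1 because q is squeezed to 1, and its consecutive products are
    1 + O(m^-(n+2)) because q solves the equation exactly and P up to that order. Then
    [two_step_rate] gives rho = 1 + O(m^-(n+1)), one power less than the truncation order. *)
Lemma expansion_of_functional_equation (q : nat -> R) (n : nat) :
  (forall m, (2 <= m)%nat -> q m * q (m - 1)%nat * (1 - / INR m) = 1) ->
  (forall m, (1 <= m)%nat -> 1 <= q m <= 1 + / INR m) ->
  exists (K : R) (n0 : nat), forall m, (n0 <= m)%nat -> (1 <= m)%nat ->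
    Rabs (q m - psum (S (S n)) (conv cc cc) (/ INR m)) <= K / INR m ^ S n.
Proof.
  intros Hq Hb.
  set (P := psum (S (S n)) cc).
  destruct (psum_functional_equation (S n) cc (fun k => Derive_n fermi k 0))
    as [K1 H1]; [reflexivity|exact cc_conv|exact fermi_btrans|].
  fold P in H1.
  destruct (jet_remainder (S (S n)) 1 (fun u => P u * P u) (conv cc cc)) as [K2 H2].
  { apply jet_mult; apply jet_psum. }
  destruct (jet_remainder 1 1 P cc) as [K3 H3].
  { generalize (jet_psum (S (S n)) 1 cc). fold P. generalize n.
    induction n0 as [|p IH]; intros H; apply jet_pred in H; auto. }
  set (rho := fun m => P (/ INR m) ^ 2 / q m).
  assert (Inv : forall m, (1 <= m)%nat -> 0 < / INR m <= 1).
  { intros m Hm. split.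
    - apply Rinv_0_lt_compat, lt_0_INR. lia.
    - rewrite <- Rinv_1. apply Rinv_le_contravar; [lra|]. apply (le_INR 1). lia. }
  assert (L0 : is_lim_seq (fun m => / INR m) 0).
  { apply (is_lim_seq_inv INR p_infty); [apply is_lim_seq_INR|easy]. }
  assert (LP : is_lim_seq (fun m => P (/ INR m)) 1).
  { apply is_lim_seq_ext with (fun m => 1 + (P (/ INR m) - 1)); [intros; ring|].
    replace (Finite 1) with (Finite (1 + 0)) by (f_equal; ring).
    apply is_lim_seq_plus'; [apply is_lim_seq_const|].
    apply is_lim_seq_abs_0.
    apply is_lim_seq_le_le_loc with (u := fun _ => 0) (w := fun m => K3 * / INR m).
    - exists 1%nat. intros m Hm. split; [apply Rabs_pos|].
      specialize (H3 _ (Inv m Hm)). simpl in H3.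
      replace (cc 0 + / INR m * 0) with 1 in H3.
      + lra.
      + change (cc 0) with 1. ring.
    - apply is_lim_seq_const.
    - replace (Finite 0) with (Finite (K3 * 0)) by (f_equal; ring).
      apply (is_lim_seq_scal_l _ K3 0 L0). }
  assert (Lq : is_lim_seq q 1).
  { apply is_lim_seq_le_le_loc with (u := fun _ => 1) (w := fun m => 1 + / INR m).
    - exists 1%nat. intros m Hm. now apply Hb.
    - apply is_lim_seq_const.
    - replace (Finite 1) with (Finite (1 + 0)) by (f_equal; ring).
      apply is_lim_seq_plus'; [apply is_lim_seq_const|exact L0]. }
  assert (Lr : is_lim_seq rho 1).
  { replace (Finite 1) with (Finite (1 * (1 * 1) / 1)) by (f_equal; field).
    unfold rho. apply is_lim_seq_div'; [|exact Lq|lra].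
    apply is_lim_seq_ext with (fun m => P (/ INR m) * (P (/ INR m) * 1)); [intros; simpl; ring|].
    apply is_lim_seq_mult'; [exact LP|].
    apply is_lim_seq_mult'; [exact LP|apply is_lim_seq_const]. }
  destruct (two_step_rate rho (fun m => rho m * rho (m - 1)%nat - 1) n K1)
    as [L [n0 HL]]; [intros; ring| |exact Lr|].
  { intros m Hm.
    assert (Hi : 0 < / INR m <= 1/2).
    { split; [apply Inv; lia|]. replace (1/2) with (/ 2) by field.
      apply Rinv_le_contravar; [lra|]. apply (le_INR 2). lia. }
    specialize (H1 _ Hi).
    assert (Ev : / INR m / (1 - / INR m) = / INR (m - 1)).
    { rewrite minus_INR by lia. assert (2 <= INR m) by (apply (le_INR 2); lia).
      simpl (INR 1). field. lra. }
    rewrite Ev in H1. rewrite pow_inv in H1.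
    replace (rho m * rho (m - 1)%nat - 1)
      with ((P (/ INR m) * P (/ INR (m - 1))) ^ 2 * (1 - / INR m) - 1); [exact H1|].
    unfold rho. specialize (Hq m Hm).
    assert (Q1 := Hb m ltac:(lia)). assert (Q2 := Hb (m - 1)%nat ltac:(lia)).
    replace (1 - / INR m) with (/ (q m * q (m - 1)%nat)).
    - field. lra.
    - apply Rmult_eq_reg_l with (q m * q (m - 1)%nat); [|nra].
      rewrite Hq. field. lra. }
  (* Split q minus the sum as -q (rho - 1) plus the truncation error of P^2; the 2 bounds q. *)
  exists (2 * L + K2), n0. intros m Hm Hm1.
  specialize (HL m Hm). specialize (H2 _ (Inv m Hm1)). specialize (Hb m Hm1).
  pose proof (Inv m Hm1) as Hi.
  assert (Hx : 0 < INR m) by (apply lt_0_INR; lia).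
  replace (q m - psum (S (S n)) (conv cc cc) (/ INR m)) with
    (q m * - (rho m - 1)
     + (P (/ INR m) * P (/ INR m) - psum (S (S n)) (conv cc cc) (/ INR m)))
    by (unfold rho; field; lra).
  replace ((2 * L + K2) / INR m ^ S n) with (2 * (L / INR m ^ S n) + K2 * (/ INR m) ^ S n)
    by (rewrite pow_inv; field; apply pow_nonzero; lra).
  apply Rabs_plus_le.
  - apply Rabs_mult_le; [rewrite Rabs_right; lra|now rewrite Rabs_Ropp].
  - apply Rle_trans with (1 := H2).
    assert (Hp : 0 < (/ INR m) ^ S (S n)) by (apply pow_lt; lra).
    assert (HK2 : 0 <= K2).
    { pose proof (Rabs_pos (P (/ INR m) * P (/ INR m)
        - psum (S (S n)) (conv cc cc) (/ INR m))) as A. nra. }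
    apply Rmult_le_compat_l; [assumption|].
    change ((/ INR m) ^ S (S n)) with (/ INR m * (/ INR m) ^ S n).
    assert (0 < (/ INR m) ^ S n) by (apply pow_lt; lra). nra.
Qed.

(** * The Gamma function *)

(** For a nonnegative integrand the integral grows with the interval, so the improper integral is
    the supremum over all intervals. *)
Lemma is_RInt_gen_bounded (f : R -> R) (B : R) :
  (forall t, 0 < t -> continuous f t) -> (forall t, 0 < t -> 0 <= f t) ->
  (forall a b, 0 < a < b -> RInt f a b <= B) ->
  exists l, is_RInt_gen f (at_right 0) (Rbar_locally p_infty) l /\
    forall a b, 0 < a < b -> RInt f a b <= l.
Proof.
  intros Hc Hp HB.
  assert (Ex : forall a b, 0 < a -> 0 < b -> ex_RInt f a b).
  { intros a b Ha Hb. apply (ex_RInt_continuous (V := R_CompleteNormedModule)).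
    intros z Hz. apply Hc. apply Rlt_le_trans with (2 := proj1 Hz).
    now apply Rmin_glb_lt. }
  destruct (completeness (fun y => exists a b, 0 < a < b /\ y = RInt f a b))
    as [l [Hub Hlub]].
  - exists B. intros y (a & b & Hab & ->). now apply HB.
  - exists (RInt f 1 2), 1, 2. split; [lra|reflexivity].
  - assert (Hle : forall a b, 0 < a < b -> RInt f a b <= l)
      by (intros a b Hab; apply Hub; eauto).
    exists l. split; [|exact Hle].
    intros P [eps HP].
    destruct (Classical_Prop.classic
      (exists a b, 0 < a < b /\ l - eps < RInt f a b)) as [(a0 & b0 & Hab & Hl)|H].
    + apply (Filter_prod _ _ _ (fun a => 0 < a < a0) (fun b => b0 < b)).
      * exists (mkposreal a0 (proj1 Hab)). intros y Hy Hy0. split; [assumption|].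
        unfold ball in Hy; simpl in Hy; unfold AbsRing_ball, abs, minus, plus, opp in Hy.
        simpl in Hy. apply Rabs_def2 in Hy. lra.
      * exists b0. auto.
      * intros a b Ha Hb. simpl. exists (RInt f a b). split.
        { apply (RInt_correct (V := R_CompleteNormedModule)), Ex; lra. }
        apply HP. unfold ball; simpl; unfold AbsRing_ball, abs, minus, plus, opp; simpl.
        specialize (Hle a b ltac:(lra)).
        assert (RInt f a0 b0 <= RInt f a b).
        { rewrite <- (RInt_Chasles f a a0 b), <- (RInt_Chasles f a0 b0 b)
            by (apply Ex; lra).
          assert (0 <= RInt f a a0) by (apply RInt_ge_0; [lra|apply Ex; lra|];
            intros; apply Hp; lra).
          assert (0 <= RInt f b0 b) by (apply RInt_ge_0; [lra|apply Ex; lra|];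
            intros; apply Hp; lra).
          unfold plus; simpl. lra. }
        apply Rabs_def1; lra.
    + exfalso. assert (l <= l - eps); [|pose proof (cond_pos eps); lra].
      apply Hlub. intros y (a & b & Hab & ->).
      destruct (Rle_or_lt (RInt f a b) (l - eps)); [assumption|]. exfalso. eauto.
Qed.

(** Apply ln y <= y - 1 at y = t/(2p+2), which gives M = (2p+2)^p; the summand 2 keeps the
    denominator positive at p = 0. *)
Lemma Rpower_exp_le (p : R) : 0 <= p ->
  exists M, 0 < M /\ forall t, 0 < t -> Rpower t p * exp (- t) <= M * exp (- (t / 2)).
Proof.
  intros Hp. exists (exp (p * ln (2 * p + 2))). split; [apply exp_pos|].
  intros t Ht. unfold Rpower. rewrite <- !exp_plus.
  assert (H : p * ln t + - t <= p * ln (2 * p + 2) + - (t / 2)).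
  { assert (Hl : ln (t / (2 * p + 2)) <= t / (2 * p + 2) - 1).
    { assert (Hq : 0 < t / (2 * p + 2)) by (apply Rdiv_lt_0_compat; lra).
      pose proof (exp_ineq1_le (ln (t / (2 * p + 2)))) as E. rewrite exp_ln in E; lra. }
    rewrite ln_div in Hl by lra.
    assert (p * (t / (2 * p + 2)) <= t / 2).
    { apply Rmult_le_reg_r with (2 * p + 2); [lra|]. field_simplify; [|lra]. nra. }
    nra. }
  destruct H as [H|H]; [left; now apply exp_increasing|right; now rewrite H].
Qed.

Lemma continuous_Gamma_integrand (p t : R) : 0 < t ->
  continuous (fun t => Rpower t p * exp (- t)) t.
Proof.
  intros Ht. apply (ex_derive_continuous (V := R_NormedModule)).
  unfold Rpower. auto_derive. exact Ht.
Qed.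

(** For x >= 1 the exponent is nonnegative, so the integrand is dominated by M e^(-t/2) on the whole
    half-line and every partial integral is at most 2M. The integral over [1, 2] gives
    positivity. *)
Lemma Gamma_correct (x : R) : 1 <= x ->
  is_RInt_gen (fun t => Rpower t (x - 1) * exp (- t))
    (at_right 0) (Rbar_locally p_infty) (Gamma x) /\ 0 < Gamma x.
Proof.
  intros Hx. set (f := fun t => Rpower t (x - 1) * exp (- t)).
  assert (Hc : forall t, 0 < t -> continuous f t)
    by (intros; now apply continuous_Gamma_integrand).
  assert (Hp : forall t, 0 < f t)
    by (intros; apply Rmult_lt_0_compat; apply exp_pos).
  destruct (Rpower_exp_le (x - 1)) as [M [HM H]]; [lra|].
  destruct (is_RInt_gen_bounded f (2 * M)) as [l [Hl Hle]].
  - exact Hc.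
  - intros. now apply Rlt_le.
  - intros a b Hab.
    assert (HI : is_RInt (fun t => M * exp (- (t / 2))) a b
      (- 2 * M * exp (- (b / 2)) - (- 2 * M * exp (- (a / 2))))).
    { apply (is_RInt_derive (fun t => - 2 * M * exp (- (t / 2)))
        (fun t => M * exp (- (t / 2)))).
      - intros t _. auto_derive; [easy|]. unfold Rdiv. field.
      - intros t _. apply (ex_derive_continuous (V := R_NormedModule)).
        auto_derive. easy. }
    apply Rle_trans with (RInt (fun t => M * exp (- (t / 2))) a b).
    + apply RInt_le; [lra| | |].
      * apply (ex_RInt_continuous (V := R_CompleteNormedModule)).
        intros z Hz. rewrite Rmin_left in Hz by lra. apply Hc. lra.
      * eexists. exact HI.
      * intros t Ht. apply H. lra.
    + rewrite (is_RInt_unique _ _ _ _ HI).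
      assert (0 < exp (- (b / 2))) by apply exp_pos.
      assert (exp (- (a / 2)) <= 1).
      { rewrite <- exp_0. left. apply exp_increasing. lra. }
      nra.
  - assert (E : Gamma x = l).
    { unfold Gamma. fold f. now apply is_RInt_gen_unique. }
    rewrite E. split; [exact Hl|].
    apply Rlt_le_trans with (RInt f 1 2); [|apply Hle; lra].
    apply RInt_gt_0; [lra|intros; apply Hp|intros; apply Hc; lra].
Qed.

(** Integration by parts: the difference of the two integrands is the derivative of F(t) = -t^x
    e^(-t), which vanishes at both ends. *)
Lemma Gamma_S (x : R) : 1 <= x -> Gamma (x + 1) = x * Gamma x.
Proof.
  intros Hx.
  destruct (Gamma_correct x Hx) as [H1 _].
  destruct (Gamma_correct (x + 1) ltac:(lra)) as [H2 _].
  set (F := fun t => - (Rpower t x * exp (- t))).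
  assert (D : forall t, 0 < t -> is_derive F t
    (Rpower t (x + 1 - 1) * exp (- t) - x * (Rpower t (x - 1) * exp (- t)))).
  { intros t Ht. unfold F, Rpower. auto_derive; [exact Ht|].
    replace (x + 1 - 1) with x by ring.
    replace ((x - 1) * ln t) with (x * ln t + - ln t) by ring.
    rewrite exp_plus, (exp_Ropp (ln t)), exp_ln by exact Ht. field. lra. }
  assert (Hz : forall a b t, 0 < a -> 0 < b -> Rmin a b <= t -> 0 < t).
  { intros a b t Ha Hb Ht. apply Rlt_le_trans with (2 := Ht). now apply Rmin_glb_lt. }
  assert (Ev : filter_prod (at_right 0) (Rbar_locally p_infty)
    (fun ab : R * R => 0 < fst ab /\ 0 < snd ab)).
  { apply (Filter_prod _ _ _ (fun a => 0 < a) (fun b => 0 < b)).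
    - exists (mkposreal 1 Rlt_0_1). auto.
    - exists 0. auto.
    - auto. }
  assert (HF : is_RInt_gen (Derive F) (at_right 0) (Rbar_locally p_infty) (0 - 0)).
  { apply is_RInt_gen_Derive.
    - apply filter_imp with (2 := Ev). intros [a b] [Ha Hb] t Ht. simpl in *.
      eexists. apply D. now apply (Hz a b).
    - apply filter_imp with (2 := Ev). intros [a b] [Ha Hb] t Ht. simpl in *.
      assert (Ht0 : 0 < t) by now apply (Hz a b).
      apply continuous_ext_loc with
        (g := fun t => Rpower t (x + 1 - 1) * exp (- t) - x * (Rpower t (x - 1) * exp (- t))).
      + exists (mkposreal t Ht0). intros y Hy.
        unfold ball in Hy; simpl in Hy; unfold AbsRing_ball, abs, minus, plus, opp in Hy.
        simpl in Hy. apply Rabs_def2 in Hy.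
        symmetry. apply is_derive_unique, D. lra.
      + apply (ex_derive_continuous (V := R_NormedModule)).
        unfold Rpower. auto_derive. auto.
    (* Near 0, x >= 1 and ln t < 0 give t^x e^(-t) <= t. *)
    - apply filterlim_locally. intros eps.
      assert (He : 0 < Rmin 1 eps) by (apply Rmin_glb_lt; [lra|apply cond_pos]).
      exists (mkposreal _ He). intros t Ht Ht0.
      unfold ball in *; simpl in *; unfold AbsRing_ball, abs, minus, plus, opp in *.
      simpl in *. apply Rabs_def2 in Ht.
      pose proof (Rmin_l 1 eps). pose proof (Rmin_r 1 eps).
      assert (Hl : ln t < 0) by (rewrite <- ln_1; apply ln_increasing; lra).
      assert (A : exp (x * ln t + - t) < eps).
      { apply Rle_lt_trans with t; [|lra]. rewrite <- (exp_ln t) at 3 by lra.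
        left. apply exp_increasing. nra. }
      unfold F, Rpower. rewrite <- exp_plus.
      pose proof (exp_pos (x * ln t + - t)). apply Rabs_def1; lra.
    (* At infinity, t^x e^(-t) <= M e^(-t/2) <= 2M/t, by e^s >= 1 + s. *)
    - apply filterlim_locally. intros eps.
      destruct (Rpower_exp_le x) as [M [HM H]]; [lra|].
      assert (He := cond_pos eps).
      assert (Hq : 0 < 2 * M / eps) by (apply Rdiv_lt_0_compat; lra).
      exists (2 * M / eps). intros t Ht.
      unfold ball in *; simpl in *; unfold AbsRing_ball, abs, minus, plus, opp in *.
      simpl in *.
      assert (Ht0 : 0 < t) by lra. specialize (H t Ht0).
      assert (A : M * exp (- (t / 2)) < eps).
      { rewrite exp_Ropp. pose proof (exp_ineq1_le (t / 2)) as E.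
        apply Rle_lt_trans with (M * / (t / 2)).
        - apply Rmult_le_compat_l; [lra|]. apply Rinv_le_contravar; lra.
        - apply Rmult_lt_reg_r with (t / eps); [apply Rdiv_lt_0_compat; lra|].
          replace (M * / (t / 2) * (t / eps)) with (2 * M / eps) by (field; lra).
          replace (eps * (t / eps)) with t by (field; lra). exact Ht. }
      assert (0 < Rpower t x * exp (- t)) by (apply Rmult_lt_0_compat; apply exp_pos).
      unfold F. apply Rabs_def1; lra. }
  pose proof (is_RInt_gen_minus _ _ _ _ H2 (is_RInt_gen_scal _ x _ H1)) as HG.
  assert (HF' : is_RInt_gen (fun t => minus (Rpower t (x + 1 - 1) * exp (- t))
      (scal x (Rpower t (x - 1) * exp (- t))))
    (at_right 0) (Rbar_locally p_infty) (0 - 0)).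
  { apply is_RInt_gen_ext with (2 := HF).
    apply filter_imp with (2 := Ev). intros [a b] [Ha Hb] t Ht. simpl in *.
    apply is_derive_unique, D. apply (Hz a b); lra. }
  pose proof (is_RInt_gen_unique (V := R_CompleteNormedModule) _ _ HG) as E1.
  pose proof (is_RInt_gen_unique (V := R_CompleteNormedModule) _ _ HF') as E2.
  pose proof (eq_trans (eq_sym E1) E2) as E. unfold minus, plus, opp, scal in E. simpl in E.
  unfold mult in E. simpl in E. lra.
Qed.

(** Integrate sqrt t <= l/2 + t/(2l) against t^(x-1) e^(-t). With l = sqrt x and Gamma(x+1) = x
    Gamma(x), the right side becomes l Gamma(x). *)
Lemma Gamma_half_le (x : R) : 1 <= x -> Gamma (x + 1/2) <= sqrt x * Gamma x.
Proof.
  intros Hx.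
  destruct (Gamma_correct x Hx) as [H1 _].
  destruct (Gamma_correct (x + 1/2) ltac:(lra)) as [H2 _].
  destruct (Gamma_correct (x + 1) ltac:(lra)) as [H3 _].
  assert (Hs : 0 < sqrt x) by (apply sqrt_lt_R0; lra).
  assert (Hss : sqrt x * sqrt x = x) by (apply sqrt_sqrt; lra).
  set (l := sqrt x) in *.
  pose proof (is_RInt_gen_plus _ _ _ _
    (is_RInt_gen_scal _ (l / 2) _ H1) (is_RInt_gen_scal _ (/ (2 * l)) _ H3)) as H.
  assert (Ev : filter_prod (at_right 0) (Rbar_locally p_infty)
    (fun ab : R * R => 0 < fst ab <= 1 /\ 1 <= snd ab)).
  { apply (Filter_prod _ _ _ (fun a => 0 < a <= 1) (fun b => 1 <= b)).
    - exists (mkposreal 1 Rlt_0_1). intros y Hy Hy0.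
      unfold ball in Hy; simpl in Hy; unfold AbsRing_ball, abs, minus, plus, opp in Hy.
      simpl in Hy. apply Rabs_def2 in Hy. lra.
    - exists 1. intros. lra.
    - auto. }
  (* Monotonicity of the improper integral is obtained through [RInt_gen_norm], as the integrand is
     its own norm. *)
  apply Rle_trans with (norm (Gamma (x + 1/2))); [apply Rle_abs|].
  apply Rle_trans with (plus (scal (l / 2) (Gamma x)) (scal (/ (2 * l)) (Gamma (x + 1)))).
  - refine (RInt_gen_norm _ _ _ _ _ _ H2 H).
    + apply filter_imp with (2 := Ev). intros [a b]. simpl. lra.
    + apply filter_imp with (2 := Ev). intros [a b] [Ha Hb] t Ht. simpl in Ha, Hb, Ht.
      unfold norm, plus, scal; simpl; unfold abs, mult; simpl.
      rewrite Rabs_right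
        by (apply Rle_ge, Rlt_le, Rmult_lt_0_compat; apply exp_pos).
      replace (x + 1/2 - 1) with ((x - 1) + 1/2) by ring.
      replace (x + 1 - 1) with ((x - 1) + (1/2 + 1/2)) by field.
      rewrite !Rpower_plus. set (r := Rpower t (1/2)). set (y := Rpower t (x - 1)).
      (* AM-GM: [r <= l / 2 + r ^ 2 / (2 l)] *)
      assert (Hr : r <= l / 2 + r * r / (2 * l)).
      { apply Rmult_le_reg_r with (2 * l); [lra|]. field_simplify; [|lra].
        pose proof (pow2_ge_0 (r - l)). nra. }
      assert (Hy : 0 < y * exp (- t)) by (apply Rmult_lt_0_compat; apply exp_pos).
      replace (y * r * exp (- t)) with (y * exp (- t) * r) by ring.
      replace (l / 2 * (y * exp (- t)) + / (2 * l) * (y * (r * r) * exp (- t)))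
        with (y * exp (- t) * (l / 2 + r * r / (2 * l))) by (field; lra).
      apply Rmult_le_compat_l; lra.
  - rewrite Gamma_S by exact Hx. unfold plus, scal; simpl; unfold mult; simpl.
    right. set (g := Gamma x). rewrite <- Hss. field. lra.
Qed.

(** * Ratios of unit ball volumes *)

Lemma Omega_pos (n : nat) : 0 < Omega n.
Proof.
  unfold Omega. apply Rdiv_lt_0_compat; [apply exp_pos|].
  apply Gamma_correct. pose proof (pos_INR n). lra.
Qed.

Lemma Omega_rec (n : nat) : Omega n / Omega (S (S n)) = INR (S (S n)) / (2 * PI).
Proof.
  unfold Omega. rewrite !S_INR.
  replace ((INR n + 1 + 1) / 2) with (INR n / 2 + 1) by field.
  pose proof (pos_INR n) as Hn.
  rewrite (Gamma_S (INR n / 2 + 1)) by lra.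
  destruct (Gamma_correct (INR n / 2 + 1)) as [_ HG]; [lra|].
  rewrite Rpower_plus, Rpower_1 by apply PI_RGT_0.
  assert (HP : 0 < Rpower PI (INR n / 2)) by apply exp_pos.
  pose proof PI_RGT_0. field. repeat split; lra.
Qed.

(** The square is g^2/pi with g = Gamma(x+1/2)/Gamma(x). The bound [Gamma_half_le] at x gives the
    upper estimate, and at x + 1/2 the lower one. *)
Lemma Omega_ratio_bounds (n : nat) :
  INR (S n) / (2 * PI) <= (Omega n / Omega (S n)) ^ 2 <= (INR (S n) + 1) / (2 * PI).
Proof.
  pose proof (pos_INR n) as Hn. pose proof PI_RGT_0 as HPI.
  set (x := INR n / 2 + 1).
  assert (Hx : 1 <= x) by (unfold x; lra).
  destruct (Gamma_correct x Hx) as [_ G1].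
  destruct (Gamma_correct (x + 1/2) ltac:(lra)) as [_ G2].
  pose proof (Gamma_half_le x Hx) as U.
  pose proof (Gamma_half_le (x + 1/2) ltac:(lra)) as L.
  replace (x + 1/2 + 1/2) with (x + 1) in L by field.
  rewrite Gamma_S in L by exact Hx.
  assert (E : (Omega n / Omega (S n)) ^ 2 = (Gamma (x + 1/2) / Gamma x) ^ 2 / PI).
  { unfold Omega. rewrite S_INR.
    replace ((INR n + 1) / 2 + 1) with (x + 1/2) by (unfold x; field).
    fold x. replace ((INR n + 1) / 2) with (INR n / 2 + / 2) by field.
    rewrite Rpower_plus, Rpower_sqrt by exact HPI.
    assert (HP : 0 < Rpower PI (INR n / 2)) by apply exp_pos.
    assert (Hs : 0 < sqrt PI) by now apply sqrt_lt_R0.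
    rewrite <- (sqrt_sqrt PI) at 4 by lra. field. lra. }
  rewrite E. clear E.
  set (g := Gamma (x + 1/2) / Gamma x).
  assert (Hg : 0 < g) by now apply Rdiv_lt_0_compat.
  assert (Eg : Gamma (x + 1/2) = g * Gamma x) by (unfold g; field; lra).
  rewrite Eg in U, L.
  assert (U' : g <= sqrt x) by (apply Rmult_le_reg_r with (Gamma x); assumption).
  assert (L' : x <= sqrt (x + 1/2) * g)
    by (apply Rmult_le_reg_r with (Gamma x); [assumption|lra]).
  assert (U2 : g ^ 2 <= x).
  { rewrite <- (pow2_sqrt x) by lra. apply pow_incr. lra. }
  assert (L2 : x ^ 2 <= (x + 1/2) * g ^ 2).
  { rewrite <- (pow2_sqrt (x + 1/2)) by lra. rewrite <- Rpow_mult_distr.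
    apply pow_incr. lra. }
  (* Because (x - 1/2)(x + 1/2) <= x^2. *)
  assert (L3 : x - 1/2 <= g ^ 2) by nra.
  rewrite S_INR.
  replace ((INR n + 1) / (2 * PI)) with ((x - 1/2) / PI) by (unfold x; field; lra).
  replace ((INR n + 1 + 1) / (2 * PI)) with (x / PI) by (unfold x; field; lra).
  assert (0 < / PI) by now apply Rinv_0_lt_compat.
  split; apply Rmult_le_compat_r; lra.
Qed.

(** * Assembly of the asymptotic expansion *)

Lemma psum_last (n : nat) : forall (a : nat -> R) (u : R),
  psum (S n) a u = psum n a u + a n * u ^ n.
Proof.
  induction n as [|n IH]; intros a u; [simpl; ring|].
  change (psum (S (S n)) a u) with (a O + u * psum (S n) (fun k => a (S k)) u).
  rewrite IH. simpl. ring.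
Qed.

Lemma fsum0_psum (n : nat) (u : R) : forall a : nat -> R,
  fsum 0 n (fun k => a k * u ^ k) = psum (S n) a u.
Proof.
  induction n as [|n IH]; intros a.
  - unfold fsum. simpl. ring.
  - rewrite fsum0_S.
    change (psum (S (S n)) a u) with (a O + u * psum (S n) (fun k => a (S k)) u).
    rewrite <- IH, <- fsum_scal. simpl (u ^ 0). rewrite Rmult_1_r. f_equal.
    apply fsum_ext. intros k _. simpl. ring.
Qed.

Lemma fsum1_psum (n : nat) (a : nat -> R) (x : R) :
  fsum 1 n (fun j => a j / x ^ j) = / x * psum n (fun j => a (S j)) (/ x).
Proof.
  destruct n as [|n]; [unfold fsum; simpl; ring|].
  rewrite fsum1_S, <- fsum0_psum, <- fsum_scal. apply fsum_ext.
  intros k _. unfold Rdiv. rewrite <- pow_inv. simpl. ring.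
Qed.

Lemma psum_scal (n : nat) (c u : R) : forall a : nat -> R,
  psum n (fun k => c * a k) u = c * psum n a u.
Proof.
  induction n as [|n IH]; intros a; simpl; [ring|].
  rewrite (IH (fun k => a (S k))). ring.
Qed.

(* Asymptotic expansion: for every N,
   (Omega_{n-1}/Omega_n)^2 - (n+1/2)/(2 pi) - sum_{j=1}^N s_j n^{-j} = O(n^{-N-1}). *)
Theorem theorem10 :
  forall N : nat, exists (K : R) (n0 : nat), forall n : nat, (n0 <= n)%nat -> (1 <= n)%nat ->
    Rabs ((Omega (n - 1) / Omega n) ^ 2 - (INR n + 1/2) / (2 * PI)
          - fsum 1 N (fun j => s j / INR n ^ j))
    <= K / INR n ^ (S N).
Proof.
  intros N.
  pose proof PI_RGT_0 as HPI.
  (* T(m) is normalised by its leading term m/(2 pi). The expansion of [q] is taken to order N + 1,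
     since multiplying back by n/(2 pi) costs one power. *)
  set (q := fun m => (Omega (m - 1) / Omega m) ^ 2 * (2 * PI) / INR m).
  destruct (expansion_of_functional_equation q (S N)) as [K [n0 HK]].
  - intros [|[|m]] Hm; try lia. unfold q.
    replace (S (S m) - 1)%nat with (S m) by lia.
    replace (S m - 1)%nat with m by lia.
    assert (R := Omega_rec m).
    assert (P0 := Omega_pos m). assert (P1 := Omega_pos (S m)).
    assert (P2 := Omega_pos (S (S m))).
    replace (Omega m) with (INR (S (S m)) / (2 * PI) * Omega (S (S m)))
      by (rewrite <- R; field; lra).
    assert (M : 0 < INR (S m)) by (apply lt_0_INR; lia).
    rewrite (S_INR (S m)). field. repeat split; lra.
  - intros [|m] Hm; try lia. unfold q. replace (S m - 1)%nat with m by lia.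
    assert (M : 0 < INR (S m)) by (apply lt_0_INR; lia).
    destruct (Omega_ratio_bounds m) as [L U].
    split; (apply Rmult_le_reg_r with (INR (S m) / (2 * PI));
      [apply Rdiv_lt_0_compat; lra|]).
    + replace (_ * (2 * PI) / INR (S m) * (INR (S m) / (2 * PI)))
        with ((Omega m / Omega (S m)) ^ 2)
        by (pose proof (Omega_pos (S m)); field; repeat split; lra).
      lra.
    + replace (_ * (2 * PI) / INR (S m) * (INR (S m) / (2 * PI)))
        with ((Omega m / Omega (S m)) ^ 2)
        by (pose proof (Omega_pos (S m)); field; repeat split; lra).
      apply Rle_trans with (1 := U). right. field. lra.
  (* The expansion of [q] has one term beyond s_N; it contributes s_(N+1) n^-(N+1) and is absorbed
     into the constant. *)
  - exists (K / (2 * PI) + Rabs (s (S N))), n0. intros n Hn Hn1.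
    specialize (HK n Hn Hn1).
    assert (Hx : 0 < INR n) by (apply lt_0_INR; lia).
    assert (Hpow : 0 < INR n ^ S N) by now apply pow_lt.
    set (a := conv cc cc) in *.
    assert (Hs : forall j, s j = / (2 * PI) * a (S j)) by reflexivity.
    assert (a0 : a O = 1) by (unfold a; rewrite conv_0; apply Rmult_1_l).
    (* Together with a_0 = 1 this produces the leading part (n + 1/2)/(2 pi). Here a_1 = 2 c_1, and
       c_1 = -tau_1 = 1/4 follows from 2 tau_1 + tau_0 = 0. *)
    assert (a1 : a 1%nat = 1/2).
    { assert (c1 : cc 1 = 1/4).
      { pose proof (cc_conv 1) as E. rewrite conv_S, conv_0 in E.
        pose proof (fermi_btrans 1) as F. cbn [btrans] in F.
        assert (D0 : Derive_n fermi 0 0 = 1/2).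
        { simpl. unfold fermi. rewrite exp_0. field. }
        rewrite D0 in E, F. change (cc 0) with 1 in E. simpl (INR 1) in E. lra. }
      unfold a. rewrite conv_S, conv_0, c1. change (cc 0) with 1. field. }
    rewrite fsum1_psum.
    change (psum (S (S (S N))) a (/ INR n))
      with (a O + / INR n * (a 1%nat + / INR n * psum (S N) (fun k => a (S (S k))) (/ INR n)))
      in HK.
    rewrite psum_last, a0, a1 in HK.
    rewrite (psum_ext N (fun j => s (S j)) (fun j => / (2 * PI) * a (S (S j))))
      by (intros; apply Hs).
    rewrite psum_scal.
    set (y := psum N (fun j => a (S (S j))) (/ INR n)) in *.
    replace (_ - _ - _) with
      (INR n / (2 * PI) * (q n - (1 + / INR n * (1/2 + / INR n *
         (y + a (S (S N)) * (/ INR n) ^ N)))) + s (S N) * / INR n ^ S N).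
    + replace ((K / (2 * PI) + Rabs (s (S N))) / INR n ^ S N)
        with (INR n / (2 * PI) * (K / INR n ^ S (S N)) + Rabs (s (S N)) * / INR n ^ S N)
        by (simpl; field; repeat split; try lra; apply pow_nonzero; lra).
      apply Rabs_plus_le; apply Rabs_mult_le.
      * rewrite Rabs_right; [lra|]. apply Rle_ge, Rlt_le, Rdiv_lt_0_compat; lra.
      * exact HK.
      * lra.
      * rewrite Rabs_right; [lra|]. now apply Rle_ge, Rlt_le, Rinv_0_lt_compat.
    + rewrite Hs. unfold q. rewrite pow_inv. simpl (INR n ^ S N).
      pose proof (Omega_pos n). field.
      repeat split; try lra; apply pow_nonzero; lra.
Qed.
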